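(* Let $C\subseteq\mathbb{F}_4^6$ be the Hermitian Type IV code of length $6$, that is, a Hermitian self-dual $\mathbb{F}_4$-linear $[6,3,4]$ code containing the all-one vector. Then the codewords of fixed composition in $C$ hold $4$-colored $2$-designs; that is, for every composition $s$, the set $C_s$ of codewords of $C$ of composition $s$ is a $4$-colored $2$-design.
   Context: $\mathbb{F}_4=\{0,1,s,s^2\}$ with conjugation $\overline{a}=a^2$. A linear code $C\subseteq\mathbb{F}_4^n$ is Hermitian self-dual if $C=\{\mathbf{v}\in\mathbb{F}_4^n\mid \sum_iu_i\overline{v_i}=0\text{ for all }\mathbf{u}\in C\}$; it is a $[6,3,4]$ code if $n=6$, $\dim C=3$ and the minimum Hamming weight of a nonzero codeword is $4$. (Such a code has all weights even, i.e. is of Type IV; it is the hexacode, in the coordinate scaling where it contains $(1,1,1,1,1,1)$.) The composition of $\mathbf{u}\in\mathbb{F}_4^n$ is the tuple $(n_a(\mathbf{u}):a\in\mathbb{F}_4)$, where $n_a(\mathbf{u})$ is the number of coordinates of $\mathbf{u}$ equal to $a$. A set $D$ of vectors of $\mathbb{F}_4^n$ of one fixed composition is a $4$-colored $t$-design if (points = coordinates $1,\dots,n$; colors = elements of $\mathbb{F}_4$; each $\mathbf{u}\in D$ is a colored block giving color $u_p$ to the point $p$) for each multiset $P$ of $t$ elements of $\mathbb{F}_4$ there is a number $\lambda\ge0$ such that for every $t$-subset $T$ of $\{1,\dots,n\}$ there are exactly $\lambda$ vectors $\mathbf{u}\in D$ for which the multiset $\{u_p:p\in T\}$ equals $P$.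 *)

(* Defs.v *)
From HB Require Import structures.
From mathcomp Require Import all_boot all_order all_algebra.
From mathcomp Require Import finmap multiset.

Set Implicit Arguments.
Unset Strict Implicit.
Unset Printing Implicit Defensive.

Import GRing.Theory.
Local Open Scope ring_scope.

Section Codes.
Variables (F : finFieldType) (n : nat).
Implicit Types (C : {vspace 'rV[F]_n}) (u v : 'rV[F]_n).

(* The conjugation of a field with four elements. *)
Definition conj4 (a : F) : F := a ^+ 2.

Definition hermitian_dot u v : F := \sum_i u 0 i * conj4 (v 0 i).

Definition hermitian_dual C : {set 'rV[F]_n} :=
  [set v | [forall u in C, hermitian_dot u v == 0]].

Definition hermitian_self_dual C : Prop := C =i hermitian_dual C.

Definition hamming_weight u : nat := #|[set i | u 0 i != 0]|.

Definition has_minimum_weight C (d : nat) : Prop :=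
  (exists u, [/\ u \in C, u != 0 & hamming_weight u = d]) /\
  (forall u, u \in C -> u != 0 -> (d <= hamming_weight u)%N).

End Codes.

Section ColoredDesigns.
Variables (K : finType) (n : nat).
Implicit Types (D : {set 'rV[K]_n}) (u : 'rV[K]_n).

Definition composition u : {ffun K -> nat} :=
  [ffun a => #|[set i | u 0 i == a]|].

Definition colors_on u (T : {set 'I_n}) : {mset K}%mset :=
  seq_mset [seq u 0 p | p <- enum T].

(* A row vector u is the colored block giving color u 0 p to the point p; the
   set of colors is the whole of K. *)
Definition colored_design (t : nat) D : Prop :=
  (exists s, forall u, u \in D -> composition u = s) /\
  (forall P : {mset K}%mset, size P = t ->
     exists lambda : nat, forall T : {set 'I_n}, #|T| = t ->
       #|[set u in D | colors_on u T == P]| = lambda).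

End ColoredDesigns.

Definition codewords_of_composition (F : finFieldType) (n : nat)
    (C : {vspace 'rV[F]_n}) (s : {ffun F -> nat}) : {set 'rV[F]_n} :=
  [set u in C | composition u == s].

(* Main.v *)
(** Since 1 is in C and all weights are even, each color occurs an even number
    of times in a codeword u, and at most twice unless u is constant; hence a
    non-constant codeword misses exactly one color d and shows each of the
    other three twice. Let D be the set of codewords missing d, and let i <> j.
    For each color a <> d exactly one u in D has u_i = u_j = a: after
    translation by a, the codewords vanishing at i and j form a line whose
    three nonzero multiples miss the three different nonzero colors. So there
    are |D| - 3 words u in D with u_i <> u_j; their sums u_i + u_j are nonzero,
    and are equidistributed because D is stable under the homotheties of center
    d. Finally, {u_i, u_j} = {a, b} iff u_i + u_j = a + b, whenever a, b and d
    are distinct. *)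

Require Import Defs.
From HB Require Import structures.
From mathcomp Require Import all_boot all_order all_algebra.
From mathcomp Require Import finmap multiset.
From mathcomp Require Import finfield.
From mathcomp Require Import ring.

Set Implicit Arguments.
Unset Strict Implicit.
Unset Printing Implicit Defensive.

Import GRing.Theory.
Local Open Scope ring_scope.

(** * Compositions of vectors and projections of codes *)

Section Composition.
Variables (F : finFieldType) (n : nat).
Implicit Types (u v : 'rV[F]_n) (a b x z : F) (C : {vspace 'rV[F]_n}).

Lemma composition_affine u z b x :
  z != 0 -> composition (z *: u + const_mx b) (z * x + b) = composition u x.
Proof.
move=> z0; rewrite !ffunE; apply: eq_card => i; rewrite !inE !mxE.
by rewrite (inj_eq (addIr b)) (inj_eq (mulfI z0)).
Qed.

Lemma sum_composition u : (\sum_a composition u a)%N = n.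
Proof.
rewrite -[RHS]card_ord -sum1_card (partition_big (fun i => u 0 i) predT) //=.
by apply: eq_bigr => a _; rewrite ffunE sum1dep_card cardsE.
Qed.

Lemma hamming_weightE u : (composition u 0%R + hamming_weight u)%N = n.
Proof.
rewrite ffunE -[RHS]card_ord -(cardsC [set i | u 0 i == 0]).
by congr (_ + _)%N; apply: eq_card => i; rewrite !inE.
Qed.

Lemma composition_const a x :
  composition (const_mx a : 'rV[F]_n) x = (if a == x then n else 0)%N.
Proof.
rewrite ffunE; case: eqP => [<-|ax].
  rewrite -[RHS]card_ord -cardsT.
  by apply: eq_card => i; rewrite !inE !mxE eqxx.
by apply: eq_card0 => i; rewrite !inE !mxE; apply/eqP.
Qed.

Lemma composition_full u a : composition u a = n -> u = const_mx a.
Proof.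
rewrite ffunE => h.
have /eqP/setP h2 : [set i | u 0 i == a] == setT.
  by rewrite eqEcard subsetT cardsT card_ord h leqnn.
by apply/rowP=> i; have := h2 i; rewrite !inE mxE => /eqP.
Qed.

(** The projection of [C] to [m] coordinates has an image of dimension at most [m], hence a nonzero
    kernel. *)
Lemma vanishing_codeword C m (g : 'I_m -> 'I_n) :
  (m < \dim C)%N ->
  exists w, [/\ w \in C, w != 0 & forall k, w 0 (g k) = 0].
Proof.
move=> mC; pose f : 'Hom('rV[F]_n, 'rV[F]_m) := linfun (colsub g).
have : (C :&: lker f)%VS != 0%VS.
  apply: contraTneq mC => h; rewrite -(limg_ker_dim f) h dimv0 add0n -leqNgt.
  by rewrite (leq_trans (dimvS (subvf _))) // dimvf /dim /= mul1n.
rewrite -vpick0 => w0; have := memv_pick (C :&: lker f)%VS.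
rewrite memv_cap => /andP[wC]; rewrite memv_ker lfunE /= => /eqP/rowP wf.
by exists (vpick (C :&: lker f)%VS); split=> // k; have := wf k; rewrite !mxE.
Qed.

End Composition.

(** * Multisets of two colors *)

Lemma colors_on_pair (K : finType) n (u : 'rV[K]_n) (i j : 'I_n) :
  i != j -> colors_on u [set i; j] = seq_mset [:: u 0 i; u 0 j].
Proof.
move=> ij; apply/eq_seq_msetP; rewrite -[[:: u 0 i; _]]/(map (u 0) [:: i; j]).
apply: perm_map; apply: uniq_perm; rewrite ?enum_uniq //= ?inE ?ij //.
by move=> k; rewrite mem_enum !inE.
Qed.

Lemma perm_eq_pair (K : eqType) (a b x y : K) :
  perm_eq [:: x; y] [:: a; b] =
  (x == a) && (y == b) || (x == b) && (y == a).
Proof.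
have perm1 p q : perm_eq [:: p] [:: q] = (p == q :> K).
  by apply/idP/eqP => [/perm_mem/(_ p)|->//]; rewrite !inE eqxx => /esym/eqP.
case: (eqVneq x a) => [->|xa] /=.
  by rewrite perm_cons perm1; case: (eqVneq a b) => [->|_]; rewrite ?orbb ?orbF.
case: (eqVneq x b) => [->|xb] /=.
  by rewrite -(cat1s a) perm_sym perm_catC /= perm_cons perm1 eq_sym.
apply/negP => /perm_mem/(_ x).
by rewrite !inE eqxx (negPf xa) (negPf xb).
Qed.

(** * Arithmetic of the field with four elements *)

Section FieldOfFour.
Variables (F : finFieldType) (F_card : #|F| = 4%N).
Implicit Types (a b x z : F).

Lemma add4xx x : x + x = 0.
Proof.
(* Every element equals its fourth power, and [(-1) ^+ 4] is 1. *)
have E : 1 = -1 :> F by rewrite -[RHS]expf_card F_card -signr_odd.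
by rewrite -[x in X in X + _]mulr1 {1}E mulrN1 addNr.
Qed.

Lemma sub4E x y : x - y = x + y.
Proof.
by congr (_ + _); apply/eqP; rewrite eq_sym -addr_eq0 add4xx.
Qed.

Lemma add4_eq0 x y : (x + y == 0) = (x == y).
Proof. by rewrite -sub4E subr_eq0. Qed.

Lemma natr4E m : m%:R = (odd m)%:R :> F.
Proof.
by rewrite -{1}[m]odd_double_half natrD -addnn natrD add4xx addr0.
Qed.

(** The product is the cube of [x], and the three nonzero elements are the cube roots of 1. *)
Lemma mul4_conj x : x * conj4 x = (x != 0)%:R.
Proof.
rewrite /conj4 -exprS; case: eqP => [->|/eqP x0]; first by rewrite expr0n.
by apply: (mulfI x0); rewrite -exprS -F_card expf_card mulr1.
Qed.

Lemma card4_predC1 a : #|predC1 a| = 3%N.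
Proof. by have := cardC1 a; rewrite F_card. Qed.

(** If [x] is neither [a] nor [b], then [d], [a], [b], [x] are the four elements of the field, whose
    sum is 0; so [x + y = a + b] would force [y = d]. *)
Lemma eq_pair_sum a b d x y :
  a != b -> a != d -> b != d -> x != d -> y != d ->
  ((x == a) && (y == b) || (x == b) && (y == a)) = (x + y == a + b).
Proof.
move=> ab ad bd xd yd; apply/orP/eqP => [[]/andP[/eqP-> /eqP->] //|].
  by rewrite addrC.
move=> xy; case: (eqVneq x a) xy => [-> /addrI->|xa xy].
  by left; rewrite eqxx.
case: (eqVneq x b) xy => [->|xb xy].
  by rewrite addrC => /addIr->; right; rewrite eqxx.
(* The fourth element of the field is a + b + d. *)
exfalso; have full z : z \in [:: d; a; b; x].
  have u : uniq [:: d; a; b; x].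
    by rewrite /= !inE !negb_or !(eq_sym d) ad bd xd ab !(eq_sym _ x) xa xb.
  have : #|[:: d; a; b; x]| = #|F| by rewrite F_card (card_uniqP u).
  by move=> /subset_cardP/(_ (subset_predT _)) ->.
have := full (a + b + d); rewrite !inE; apply/negP; rewrite !negb_or.
apply/and4P; split.
- by rewrite -subr_eq0 addrK add4_eq0.
- by rewrite -addrA addrC -subr_eq0 addrK add4_eq0.
- by rewrite addrAC -subr_eq0 addrK add4_eq0.
- by rewrite -xy -addrA addrC -subr_eq0 addrK add4_eq0.
Qed.

End FieldOfFour.

(** * Compositions of the codewords *)

Section Hexacode.
Variables (F : finFieldType) (F_card : #|F| = 4%N).
Variable (C : {vspace 'rV[F]_6}).
Hypothesis C_self_dual : hermitian_self_dual C.
Hypothesis C_dim : \dim C = 3%N.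
Hypothesis C_min : has_minimum_weight C 4.
Hypothesis C_one : const_mx 1 \in C.
Implicit Types (a b d x y z : F) (u v w : 'rV[F]_6).

Lemma const_codeword a : const_mx a \in C.
Proof. by rewrite -[a]mulr1 -scalemx_const memvZ. Qed.

(** A codeword is orthogonal to itself, and its Hermitian product with itself is its weight modulo
    2. *)
Lemma even_hamming_weight u : u \in C -> ~~ odd (hamming_weight u).
Proof.
move=> uC; have := uC; rewrite C_self_dual inE => /forall_inP/(_ u uC).
rewrite /hermitian_dot (eq_bigr _ (fun i _ => mul4_conj F_card (u 0 i))).
rewrite -natr_sum -big_mkcond /= sum1dep_card -/(hamming_weight u).
by rewrite natr4E //; case: odd; rewrite ?oner_eq0.
Qed.

Lemma affine_codeword u z b : u \in C -> z *: u + const_mx b \in C.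
Proof. by move=> uC; rewrite memvD ?memvZ ?const_codeword. Qed.

Lemma composition_translate u a :
  composition (u - const_mx a) 0%R = composition u a.
Proof.
have := composition_affine u (- a) a (oner_neq0 F).
rewrite scale1r mul1r subrr => <-; congr (composition (u + _) _).
by apply/rowP=> i; rewrite !mxE.
Qed.

Lemma translate_codeword u a : u \in C -> u - const_mx a \in C.
Proof. by move=> uC; rewrite memvB ?const_codeword. Qed.

(** Subtracting the constant word turns the occurrences of [a] into zeros, whose number is 6 minus
    an even weight. *)
Lemma even_composition u a : u \in C -> ~~ odd (composition u a).
Proof.
move/(translate_codeword a) => uC; have := hamming_weightE (u - const_mx a).
rewrite composition_translate => /(congr1 odd); rewrite oddD.
by rewrite (negPf (even_hamming_weight uC)) addbF => ->.
Qed.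

(** The nonzero codeword [u - const_mx a] has weight at least 4, so at most two zeros. *)
Lemma composition_le2 u a : u \in C -> u != const_mx a ->
  (composition u a <= 2)%N.
Proof.
rewrite -subr_eq0 => /(translate_codeword a) uC u0.
have := hamming_weightE (u - const_mx a); rewrite composition_translate.
have [_ /(_ _ uC u0) h] := C_min.
by move=> e; rewrite -(leq_add2r 4) (leq_trans _ (eq_leq e)) // leq_add2l.
Qed.

Definition nonconstant u := [forall a, u != const_mx a].

Definition composition_missing d : {ffun F -> nat} :=
  [ffun a => if a == d then 0 else 2]%N.

(** Three colors, each used at most twice, share the six coordinates, so each bound is attained. *)
Lemma missing_composition u d : u \in C -> nonconstant u ->
  composition u d = 0%N -> composition u = composition_missing d.
Proof.
move=> uC /forallP un ud; apply/ffunP => a; rewrite [RHS]ffunE.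
case: (eqVneq a d) => [->//|ad].
have := sum_composition u; rewrite (bigD1 d) //= ud add0n.
rewrite (bigD1 a) //= => e.
have le4 : (\sum_(i | (i != d) && (i != a)) composition u i <= 4)%N.
  rewrite (@leq_trans (\sum_(i | (i != d) && (i != a)) 2)%N) //.
    by apply: leq_sum => i _; exact: composition_le2.
  rewrite sum_nat_const -[leqRHS]/(2 * 2)%N leq_mul2r /=.
  have := card4_predC1 F_card d; rewrite (cardD1 a) inE ad => -[].
  move=> h; rewrite -ltnS -h ltnS; apply/subset_leq_card/subsetP=> i.
  by rewrite !inE andbC.
apply/eqP; rewrite eqn_leq composition_le2 //=.
by rewrite -(leq_add2r 4) (leq_trans (eq_leq (esym e))) // leq_add2l.
Qed.

Lemma missing_color u : u \in C -> nonconstant u ->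
  exists d, composition u d = 0%N.
Proof.
move=> uC /forallP un.
have [/existsP[d /eqP]|] := boolP [exists d, composition u d == 0%N].
  by exists d.
rewrite negb_exists => /forallP h.
(* Were no color missing, each count, being even, positive and at most 2, would be 2, giving a total
   of 8 instead of 6. *)
have := sum_composition u; rewrite (eq_bigr (fun=> 2%N)).
  by rewrite sum_nat_const F_card.
move=> a _; have := h a; have := even_composition a uC.
by have := composition_le2 uC (un a); case: (composition u a) => [|[|[]]].
Qed.

(** * Nonconstant codewords that miss a given color *)

Definition missing d := codewords_of_composition C (composition_missing d).

Lemma mem_missing d u :
  (u \in missing d) = [&& u \in C, nonconstant u & composition u d == 0%N].
Proof.
rewrite inE; apply/andP/and3P => [[uC /eqP uE]|[uC un /eqP ud]]; split=> //.
- apply/forallP => a; apply/eqP => ua; have /ffunP/(_ a) := uE.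
  by rewrite ua composition_const eqxx ffunE; case: eqP.
- by rewrite uE ffunE eqxx.
- by rewrite (missing_composition uC un ud).
Qed.

Lemma missing_neq d u i : u \in missing d -> u 0 i != d.
Proof.
rewrite mem_missing => /and3P[_ _]; rewrite ffunE cards_eq0 => /eqP/setP/(_ i).
by rewrite !inE => ->.
Qed.

Lemma missing_color_inj d e u : u \in missing d -> u \in missing e -> d = e.
Proof.
move=> uD; rewrite mem_missing => /and3P[_ _]; move: uD.
by rewrite inE => /andP[_ /eqP->]; rewrite ffunE; case: (eqVneq e d) => [->|].
Qed.

Lemma nonconstant_affine u z b : z != 0 -> nonconstant u ->
  nonconstant (z *: u + const_mx b).
Proof.
move=> z0 /forallP un; apply/forallP=> a.
apply: contra (un (z^-1 * (a - b))) => /eqP e.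
apply/eqP/rowP => i; have /rowP/(_ i) := e; rewrite !mxE => <-.
by rewrite addrK mulKf.
Qed.

(** Since [C] contains the constants, it is stable under affine maps of the alphabet, and the
    missing color moves along. *)
Lemma missing_affine d u z b : z != 0 -> u \in missing d ->
  z *: u + const_mx b \in missing (z * d + b).
Proof.
move=> z0; rewrite !mem_missing => /and3P[uC un ud].
by rewrite affine_codeword // nonconstant_affine // composition_affine.
Qed.

(* Any three coordinates form an information set. *)
Lemma zero_codeword u i j k : u \in C -> i != j -> k != i -> k != j ->
  u 0 i = 0 -> u 0 j = 0 -> u 0 k = 0 -> u = 0.
Proof.
move=> uC ij ki kj ui uj uk; apply/eqP/contraT => u0.
have := composition_le2 (a := 0) uC u0; rewrite ffunE leqNgt => /negP[].
apply: leq_trans (_ : #|[set k; i; j]| <= _)%N.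
  by rewrite -setUA cardsU1 cards2 !inE negb_or ki kj ij.
apply/subset_leq_card/subsetP=> l; rewrite !inE -orbA.
by case/or3P=> /eqP->; apply/eqP.
Qed.

Lemma missing_unique d a i j u v : i != j ->
  u \in missing d -> v \in missing d ->
  u 0 i = a -> u 0 j = a -> v 0 i = a -> v 0 j = a -> u = v.
Proof.
move=> ij uD vD ui uj vi vj.
have [uC /forallP un _] := and3P (etrans (esym (mem_missing d u)) uD).
have [vC /forallP vn vd] := and3P (etrans (esym (mem_missing d v)) vD).
have [k uk] : exists k, u 0 k != a.
  apply/existsP; apply: contraT; rewrite negb_exists => /forallP h.
  case/eqP: (un a); apply/rowP => k; rewrite mxE.
  by have := h k; rewrite negbK => /eqP.
have ki : k != i by apply: contraNneq uk => ->; rewrite ui.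
have kj : k != j by apply: contraNneq uk => ->; rewrite uj.
rewrite -subr_eq0 in uk.
(* This is the ratio of the homothety of center [a] that takes [u] to a word agreeing with [v] at
   [k], as well as at [i] and [j]. *)
pose z := (v 0 k - a) / (u 0 k - a).
have vE : v = z *: u + const_mx (a - z * a).
  apply/eqP; rewrite -subr_eq0; apply/eqP.
  apply: (zero_codeword _ ij ki kj); first by rewrite memvB ?affine_codeword.
  - by rewrite !mxE vi ui; ring.
  - by rewrite !mxE vj uj; ring.
  by rewrite !mxE /z; field.
have z0 : z != 0.
  apply: contraNneq (vn a) => z0.
  by rewrite vE z0 scale0r add0r mul0r subr0.
have ad : d - a != 0 by rewrite subr_eq0 eq_sym -ui missing_neq.
(* The homothety sends the missing color [d] of [u] to that of [v], which is again [d]; as [d] is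
   not the center, [z] is 1. *)
have : z * d + (a - z * a) = d.
  by apply: (missing_color_inj (u := v)); rewrite // vE missing_affine.
move/eqP; rewrite -subr_eq0 (_ : _ - _ = (z - 1) * (d - a)); last by ring.
rewrite mulf_eq0 (negPf ad) orbF subr_eq0 => /eqP z1.
by rewrite vE z1 mul1r subrr scale1r; apply/rowP=> l; rewrite !mxE addr0.
Qed.

(** A nonzero codeword vanishing at [i] and [j] misses some color [c != 0]; the affine map sending 0
    to [a] and [c] to [d] then gives the word sought. *)
Lemma missing_exists d a i j : a != d ->
  exists u, [/\ u \in missing d, u 0 i = a & u 0 j = a].
Proof.
move=> ad; have lt2C : (2 < \dim C)%N by rewrite C_dim.
have [w [wC w0 wij]] := vanishing_codeword (tnth [tuple i; j]) lt2C.
have wi : w 0 i = 0 by have := wij ord0.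
have wj : w 0 j = 0 by have := wij (lift ord0 ord0).
have wn : nonconstant w.
  apply/forallP => c; apply: contraNneq w0 => wc; move: wi.
  by rewrite wc mxE => ->; apply/eqP/rowP => k; rewrite !mxE.
have [c wc] := missing_color wC wn.
have wD : w \in missing c by rewrite mem_missing wC wn wc /=.
have c0 : c != 0 by rewrite eq_sym -wi missing_neq.
have z0 : (d - a) / c != 0 by rewrite mulf_neq0 ?invr_eq0 // subr_eq0 eq_sym.
exists ((d - a) / c *: w + const_mx a); split.
- by have := missing_affine a z0 wD; rewrite divfK // subrK.
- by rewrite !mxE wi mulr0 add0r.
- by rewrite !mxE wj mulr0 add0r.
Qed.

(** * Counting by the colors at two points *)

Lemma card_missing_color2 d a i j : i != j ->
  #|[set u in missing d | (u 0 i == a) && (u 0 j == a)]| = (a != d).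
Proof.
move=> ij; case: (eqVneq a d) => [->|ad] /=.
  apply: eq_card0 => u; rewrite in_set; apply/negP => /and3P[uD ui _].
  by have := missing_neq i uD; rewrite ui.
have [u [uD ui uj]] := missing_exists i j ad.
apply: etrans (cards1 u); apply: eq_card => v; rewrite in_set in_set1.
apply/and3P/eqP => [[vD /eqP vi /eqP vj]|->]; last by rewrite uD ui uj.
exact: (missing_unique ij vD uD vi vj).
Qed.

(** In characteristic 2 a zero sum means equal colors, and each of the three colors other than [d]
    contributes one word. *)
Lemma card_missing_sum0 d i j : i != j ->
  #|[set u in missing d | u 0 i + u 0 j == 0]| = 3%N.
Proof.
move=> ij; rewrite -sum1_card (partition_big (fun u => u 0 i) predT) //=.
rewrite (eq_bigr (fun a => nat_of_bool (a != d))) => [|a _].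
  by rewrite -big_mkcond /= sum1_card card4_predC1.
rewrite -(card_missing_color2 d a ij) sum1dep_card cardsE.
apply: eq_card => u; rewrite -[LHS]/((_ \in finset _) && _).
rewrite in_set [RHS]in_set -andbA add4_eq0 //; congr (_ && _).
apply/andP/andP => -[]; first by move=> /eqP-> ->.
by move=> /eqP-> /eqP->; rewrite eqxx.
Qed.

(** The homothety of center [d] and ratio [z] preserves [missing d]; its translation part cancels in
    [u 0 i + u 0 j], so it multiplies this sum by [z]. *)
Lemma leq_card_missing_sum d i j x z : z != 0 ->
  (#|[set u in missing d | (u 0 i + u 0 j == x)%R]| <=
   #|[set u in missing d | (u 0 i + u 0 j == z * x)%R]|)%N.
Proof.
move=> z0; pose f u := z *: u + const_mx (d - z * d).
have f_inj : injective f by move=> u v /addIr/(scalerI z0).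
rewrite -(card_imset _ f_inj).
apply/subset_leq_card/subsetP => _ /imsetP[u + ->].
rewrite [u \in _]in_set [f u \in _]in_set => /andP[uD /eqP <-].
have := missing_affine (d - z * d) z0 uD; rewrite subrKC => -> /=.
by rewrite !mxE addrACA add4xx // addr0 mulrDr.
Qed.

(** The three nonzero sums share equally the words whose colors at [i] and [j] differ. The
    subtraction and the division are exact. *)
Lemma card_missing_sum d i j x : i != j -> x != 0 ->
  #|[set u in missing d | u 0 i + u 0 j == x]| = ((#|missing d| - 3) %/ 3)%N.
Proof.
move=> ij x0; pose N y := #|[set u in missing d | u 0 i + u 0 j == y]|.
have NE y : y != 0 -> N y = N x.
  move=> y0; apply/eqP; rewrite eqn_leq /N.
  (* The ratios [x / y] and [y / x] give the two inequalities. *)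
  have := leq_card_missing_sum d i j y (mulf_neq0 x0 (invr_neq0 y0)).
  have := leq_card_missing_sum d i j x (mulf_neq0 y0 (invr_neq0 x0)).
  by rewrite !divfK // => -> ->.
have : #|missing d| = (\sum_y N y)%N.
  rewrite -sum1_card (partition_big (fun u => u 0 i + u 0 j) predT) //=.
  by apply: eq_bigr => y _; rewrite sum1dep_card.
rewrite (bigD1 0) //= (eq_bigr _ NE) [N 0]card_missing_sum0 // sum_nat_const.
by rewrite card4_predC1 // => ->; rewrite addKn mulKn.
Qed.

(** * The designs *)

Lemma constant_codewords a :
  codewords_of_composition C (composition (const_mx a : 'rV[F]_6)) =
  [set const_mx a].
Proof.
apply/setP => u; rewrite !inE; apply/andP/eqP => [[_ /eqP uE]|->].
  by apply: composition_full; rewrite uE composition_const eqxx.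
by rewrite const_codeword.
Qed.

Lemma design_constant a :
  colored_design 2 [set const_mx a : 'rV[F]_6].
Proof.
split=> [|P _].
  by exists (composition (const_mx a : 'rV[F]_6)) => u /set1P->.
(* The boolean counts as 1 if [P] is [a] taken twice, and as 0 otherwise. *)
exists (seq_mset [:: a; a] == P) => T /eqP/cards2P[i [j [ij ->]]].
case: eqP => [PE|PE] /=.
  apply: etrans (cards1 (const_mx a : 'rV[F]_6)).
  apply: eq_card => u; rewrite !inE.
  by case: eqP => //= ->; rewrite colors_on_pair // !mxE PE eqxx.
apply: eq_card0 => u; rewrite !inE; case: eqP => //= ->.
by rewrite colors_on_pair // !mxE; apply/eqP.
Qed.

Lemma design_missing d : colored_design 2 (missing d).
Proof.
split=> [|P].
  by exists (composition_missing d) => u; rewrite inE => /andP[_ /eqP].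
move=> sP; rewrite -[P]seq_mset_id.
case: (enum_mset P) sP => [|a [|b []]] // _.
(* A repeated color other than [d] occurs in one word, a pair containing [d] in none, and any other
   pair is recognized by its nonzero sum [a + b]. *)
pose lam := (if a == b then (a != d : nat) else
  if (a == d) || (b == d) then 0 else (#|missing d| - 3) %/ 3)%N.
exists lam => T /eqP/cards2P[i [j [ij ->]]]; rewrite /lam.
have -> :
    #|[set u in missing d | colors_on u [set i; j] == seq_mset [:: a; b]]| =
    #|[set u in missing d | (u 0 i == a) && (u 0 j == b)
                         || (u 0 i == b) && (u 0 j == a)]|.
  apply: eq_card => u; rewrite [LHS]in_set [RHS]in_set colors_on_pair //.
  rewrite -perm_eq_pair.
  by congr (_ && _); apply/eqP/idP => /eq_seq_msetP.
case: (eqVneq a b) => [<-|ab].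
  rewrite -(card_missing_color2 d a ij).
  by apply: eq_card => u; rewrite [LHS]in_set [RHS]in_set orbb.
case: ifPn => [abd|]; last rewrite negb_or => /andP[ad bd].
  apply: eq_card0 => u; rewrite in_set; apply/negP => /andP[uD].
  have ui := missing_neq i uD; have uj := missing_neq j uD.
  by case/orP: abd ui uj => /eqP-> /negPf-> /negPf->; rewrite ?andbF.
rewrite -(card_missing_sum d (x := a + b) ij) ?add4_eq0 //.
apply: eq_card => u; rewrite [LHS]in_set [RHS]in_set.
case uD: (u \in missing d) => //=.
by rewrite (eq_pair_sum F_card ab ad bd) ?missing_neq.
Qed.

End Hexacode.

Theorem theorem5p12 (F : finFieldType) (F_card : #|F| = 4%N)
    (C : {vspace 'rV[F]_6})
    (C_self_dual : hermitian_self_dual C)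
    (C_dim : \dim C = 3%N)
    (C_min : has_minimum_weight C 4)
    (C_one : const_mx 1 \in C)
    (s : {ffun F -> nat}) :
  colored_design 2 (codewords_of_composition C s).
Proof.
(* An empty class is a design with [lambda] 0; otherwise any member [u] decides between a single
   constant word and a class [missing d]. *)
have [->|[u]] := set_0Vmem (codewords_of_composition C s).
  split=> [|P _]; first by exists s => u; rewrite inE.
  by exists 0%N => T _; apply: eq_card0 => u; rewrite !inE.
rewrite inE => /andP[uC /eqP <-].
have [un|] := boolP (nonconstant u); last first.
  rewrite negb_forall => /existsP[a /negPn/eqP ->].
  by rewrite constant_codewords //; exact: design_constant.
have [d ud] := missing_color F_card C_self_dual C_min C_one uC un.
rewrite (missing_composition F_card C_min C_one uC un ud).
exact: design_missing.
Qed.
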